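(* Let $n \ge 5$ be an integer. The vertex connectivity of the graph $\overline{T(n)}'$ is equal to its valency.
   Context: Graphs are finite, undirected, without loops and multiple edges; $\overline{\Gamma}$ denotes the complement of a graph $\Gamma$. The vertex connectivity $\kappa(\Gamma)$ of a graph $\Gamma$ is the minimum number of vertices whose deletion from $\Gamma$ disconnects it. For $n \ge 5$, the triangular graph $T(n)$ has as vertices all $2$-element subsets of $\{1,\ldots,n\}$, two vertices being adjacent whenever the corresponding subsets intersect in exactly one element. Thus in $\overline{T(n)}$ two vertices are adjacent exactly when the subsets are disjoint. The $\{1,2\}$-automorphism is the involutive automorphism $\phi$ of $\overline{T(n)}$ that swaps the vertices $\{1,z\}$ and $\{2,z\}$ for every $z \in \{3,4,\ldots,n\}$ and fixes all other vertices. It interchanges only non-adjacent vertices of $\overline{T(n)}$. Let $M$ be the adjacency matrix of $\overline{T(n)}$ and $P$ the permutation matrix representing $\phi$. The graph $\overline{T(n)}'$ is the graph on the same vertex set with adjacency matrix $PM$ (this is a symmetric $0/1$ matrix with zero diagonal). Equivalently, the neighbourhood of a vertex $x$ in $\overline{T(n)}'$ is the neighbourhood of $\phi(x)$ in $\overline{T(n)}$. The graph $\overline{T(n)}'$ is regular. *)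

(* Defs.v *)
From HB Require Import structures.
From mathcomp Require Import all_boot all_order all_algebra all_fingroup.

Set Implicit Arguments.
Unset Strict Implicit.
Unset Printing Implicit Defensive.

Import GRing.Theory.
Local Open Scope ring_scope.

Record sgraph := SGraph {
  vertex :> finType;
  adj : rel vertex;
  adj_sym : symmetric adj;
  adj_irrefl : irreflexive adj
}.

Definition nbhd (G : sgraph) (x : G) : {set G} := [set y | adj x y].

Definition regular (G : sgraph) (k : nat) : Prop :=
  forall x : G, #|nbhd x| = k.

Definition connected (G : sgraph) : Prop := forall x y : G, connect (@adj G) x y.

Section Complement.
Variable G : sgraph.

Definition compl_adj : rel G := fun x y => (x != y) && ~~ adj x y.

Fact compl_adj_sym : symmetric compl_adj.
Proof. by move=> x y; rewrite /compl_adj eq_sym adj_sym. Qed.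

Fact compl_adj_irrefl : irreflexive compl_adj.
Proof. by move=> x; rewrite /compl_adj eqxx. Qed.

Definition complement : sgraph := SGraph compl_adj_sym compl_adj_irrefl.

End Complement.

Section Deletion.
Variables (G : sgraph) (S : {set G}).

Definition del_adj : rel {x : G | x \notin S} := fun x y => adj (val x) (val y).

Fact del_adj_sym : symmetric del_adj.
Proof. by move=> x y; rewrite /del_adj adj_sym. Qed.

Fact del_adj_irrefl : irreflexive del_adj.
Proof. by move=> x; rewrite /del_adj adj_irrefl. Qed.

Definition delete : sgraph := SGraph del_adj_sym del_adj_irrefl.

End Deletion.

(* A relation rather than a function: no value is assigned to a complete
   graph, which no deletion disconnects.  The graph without vertices counts
   as connected, so deleting all vertices does not disconnect. *)
Definition is_vertex_connectivity (G : sgraph) (k : nat) : Prop :=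
  (exists2 S : {set G}, ~ connected (delete S) & #|S| = k)
  /\ (forall S : {set G}, ~ connected (delete S) -> (k <= #|S|)%N).

(* Matrices are indexed by the vertices through enum_val / enum_rank. *)
Definition adj_mx (G : sgraph) : 'M[int]_#|G| :=
  \matrix_(i, j) (adj (enum_val i) (enum_val j))%:R.

Definition vperm_mx (G : sgraph) (s : {perm G}) : 'M[int]_#|G| :=
  \matrix_(i, j) (s (enum_val i) == enum_val j)%:R.

Section DualSeidelSwitching.
Variables (G : sgraph) (s : {perm G}).
Hypothesis s_aut : forall x y, adj (s x) (s y) = adj x y.
Hypothesis s_inv : involutive s.
Hypothesis s_nonadj : forall x, ~~ adj (s x) x.

Definition switch_mx : 'M[int]_#|G| := vperm_mx s *m adj_mx G.

Definition switch_adj : rel G :=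
  fun x y => switch_mx (enum_rank x) (enum_rank y) == 1.

Lemma switch_mxE x y :
  switch_mx (enum_rank x) (enum_rank y) = (adj (s x) y)%:R.
Proof using.
rewrite mxE (bigD1 (enum_rank (s x))) //= big1 => [|i ne_i].
  by rewrite !mxE !enum_rankK eqxx mul1r addr0.
rewrite !mxE !enum_rankK; case: eqP => [e|_]; last by rewrite mul0r.
by rewrite e enum_valK eqxx in ne_i.
Qed.

Lemma switch_adjE x y : switch_adj x y = adj (s x) y.
Proof using. by rewrite /switch_adj switch_mxE; case: adj. Qed.

Fact switch_adj_sym : symmetric switch_adj.
Proof using s_aut s_inv.
by move=> x y; rewrite !switch_adjE -s_aut s_inv adj_sym.
Qed.

Fact switch_adj_irrefl : irreflexive switch_adj.
Proof using s_nonadj. by move=> x; rewrite switch_adjE; apply: negbTE. Qed.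

Definition dual_switch : sgraph := SGraph switch_adj_sym switch_adj_irrefl.

Lemma adj_mx_dual_switch : adj_mx dual_switch = switch_mx.
Proof using.
apply/matrixP => i j; rewrite !mxE /= switch_adjE.
by rewrite -[i in RHS]enum_valK -[j in RHS]enum_valK -switch_mxE mxE.
Qed.

End DualSeidelSwitching.

Section Triangular.
Variable n : nat.

Definition pair2 : finType := {x : {set 'I_n} | #|x| == 2}.

Definition tri_adj : rel pair2 := fun x y => #|val x :&: val y| == 1%N.

Fact tri_adj_sym : symmetric tri_adj.
Proof. by move=> x y; rewrite /tri_adj setIC. Qed.

Fact tri_adj_irrefl : irreflexive tri_adj.
Proof. by move=> x; rewrite /tri_adj setIid (eqP (valP x)). Qed.

Definition triangular : sgraph := SGraph tri_adj_sym tri_adj_irrefl.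

End Triangular.

Section PairSwap.
Variables (n : nat) (a b : 'I_n).

(* On 2-subsets: {a, z} and {b, z} are exchanged for every z outside {a, b},
   and all other 2-subsets are fixed. *)
Definition swap_set (x : {set 'I_n}) : {set 'I_n} :=
  if (a \in x) && (b \notin x) then b |: x :\ a
  else if (b \in x) && (a \notin x) then a |: x :\ b
  else x.

Lemma swap_set_tperm x : swap_set x = tperm a b @: x.
Proof using.
apply/setP => z; rewrite -[z in RHS](tpermK a b) mem_imset; last exact: perm_inj.
rewrite /swap_set; case: tpermP => [->|->|/eqP/negbTE za /eqP/negbTE zb];
  case ax: (a \in x); case bx: (b \in x);
  rewrite /= ?ax ?bx ?inE ?za ?zb ?andbT //=.
- by rewrite eqxx orbF; apply: contraFF bx => /eqP<-.
- by rewrite eqxx.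
- by rewrite eqxx.
- by rewrite eqxx orbF; apply: contraFF ax => /eqP<-.
Qed.

Fact swap_set_card (x : {set 'I_n}) : #|x| == 2 -> #|swap_set x| == 2.
Proof using. by rewrite swap_set_tperm card_imset //; apply: perm_inj. Qed.

Definition swap_pair (x : pair2 n) : pair2 n :=
  exist _ (swap_set (val x)) (swap_set_card (valP x)).

Fact swap_pairK : involutive swap_pair.
Proof using.
move=> x; apply: val_inj; rewrite /= !swap_set_tperm -imset_comp.
by rewrite -[RHS]imset_id; apply: eq_imset => z /=; rewrite tpermK.
Qed.

Definition swap_aut : {perm complement (triangular n)} :=
  perm (inv_inj swap_pairK).

Fact swap_aut_inv : involutive swap_aut.
Proof using. by move=> x; rewrite !permE swap_pairK. Qed.

Fact swap_aut_aut x y :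
  @adj (complement (triangular n)) (swap_aut x) (swap_aut y) = adj x y.
Proof using.
rewrite /= /compl_adj (inj_eq perm_inj) /= /tri_adj !permE /= !swap_set_tperm.
by rewrite -imsetI ?(card_imset _ perm_inj) // => u v _ _; apply: perm_inj.
Qed.

Fact swap_aut_nonadj x : ~~ @adj (complement (triangular n)) (swap_aut x) x.
Proof using.
rewrite /= /compl_adj negb_and !negbK /= /tri_adj permE -val_eqE /=.
rewrite /swap_set; have := valP x => /=; move: (val x) => {}x cx.
case: ifP => [/andP[ax bx]|_]; last case: ifP => [/andP[bx ax]|_];
  last by rewrite eqxx.
- apply/orP; right; rewrite setIUl.
  rewrite (_ : [set b] :&: x = set0) ?set0U.
    by rewrite (setIidPl (subsetDl _ _)); move: cx; rewrite (cardsD1 a x) ax.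
  by apply/setP => z; rewrite !inE; case: eqP => // ->; apply: negbTE.
- apply/orP; right; rewrite setIUl.
  rewrite (_ : [set a] :&: x = set0) ?set0U.
    by rewrite (setIidPl (subsetDl _ _)); move: cx; rewrite (cardsD1 b x) bx.
  by apply/setP => z; rewrite !inE; case: eqP => // ->; apply: negbTE.
Qed.

End PairSwap.

(* The ground set {1, ..., n} is 'I_n, so its elements 1 and 2 are the ordinals
   of values 0 and 1. *)
Definition elt1 n (n5 : (5 <= n)%N) : 'I_n :=
  Ordinal (leq_trans (isT : (0 < 5)%N) n5).
Definition elt2 n (n5 : (5 <= n)%N) : 'I_n :=
  Ordinal (leq_trans (isT : (1 < 5)%N) n5).

Definition co_triangular' n (n5 : (5 <= n)%N) : sgraph :=
  dual_switch (@swap_aut_aut n (elt1 n5) (elt2 n5))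
    (@swap_aut_inv n (elt1 n5) (elt2 n5))
    (@swap_aut_nonadj n (elt1 n5) (elt2 n5)).

(* Main.v *)
(** Separating [A] from [B] in the switched graph means that [phi A] and [B]
    are cross-intersecting families of 2-subsets, and [|A| + |B| <= 2n - 3] is
    wanted.  If one of the two sides is a single vertex, its neighbourhood lies
    in the separator.  Otherwise the bound holds as for Hilton-Milner, except
    when both families consist of pairs through a common point [c]; there the
    trivial bound is [2(n - 1)], and a pair through [c] fixed by [phi] cannot
    belong to both families, as [A] and [B] are disjoint. *)
Require Import Defs.
From mathcomp Require Import all_boot all_order all_algebra all_fingroup.
From mathcomp Require Import zify.

Set Implicit Arguments.
Unset Strict Implicit.
Unset Printing Implicit Defensive.

(** * Cross-intersecting families of 2-subsets *)

Section CrossIntersectingPairs.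
Variable T : finType.
Implicit Types (c : T) (x y z h : {set T}) (F H : {set {set T}}).

Definition pairs F := forall x, x \in F -> #|x| = 2.

Definition cross_intersecting F H :=
  forall x y, x \in F -> y \in H -> x :&: y != set0.

Definition star c : {set {set T}} := [set [set c; d] | d in [set~ c]].

Lemma cross_intersecting_sym F H :
  cross_intersecting F H -> cross_intersecting H F.
Proof. by move=> FH x y xH yF; rewrite setIC FH. Qed.

Lemma pair_through c x :
  #|x| = 2 -> c \in x -> exists2 d, d != c & x = [set c; d].
Proof.
move=> /eqP/cards2P[a [b [ab ->]]]; rewrite !inE => /orP[]/eqP->.
  by exists b; rewrite // eq_sym.
by exists a; rewrite // setUC.
Qed.

Lemma mem_star c x : #|x| = 2 -> c \in x -> x \in star c.
Proof.
by move=> x2 /(pair_through x2)[d dc ->]; apply: imset_f; rewrite !inE.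
Qed.

Lemma star_through c x : x \in star c -> c \in x.
Proof. by case/imsetP => d _ ->; rewrite !inE eqxx. Qed.

Lemma card_star c : #|star c| <= #|T|.-1.
Proof. by rewrite (leq_trans (leq_imset_card _ _)) // cardsC1. Qed.

(** A point of [h] in [x] and one in [y] are distinct, so they exhaust the two elements of [h]. *)
Lemma pair_meets_disjoint x y h : #|h| = 2 -> x :&: y = set0 ->
  x :&: h != set0 -> y :&: h != set0 ->
  h \in [set [set p; q] | p in x, q in y].
Proof.
move=> h2 xy0 /set0Pn[p]; rewrite inE => /andP[px ph].
move=> /set0Pn[q]; rewrite inE => /andP[qy qh].
apply/imset2P; exists p q => //; apply/esym/eqP.
have pq : p != q.
  by apply/eqP => e; have := in_set0 p; rewrite -xy0 inE px e qy.
by rewrite eqEcard cards2 pq h2 subUset !sub1set ph qh.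
Qed.

Lemma card_pairs_meeting_disjoint x y : #|x| = 2 -> #|y| = 2 ->
  #|[set [set p; q] | p in x, q in y]| <= 4.
Proof.
move=> x2 y2; rewrite curry_imset2X (leq_trans (leq_imset_card _ _)) //.
by rewrite cardsX x2 y2.
Qed.

(** A pair that avoids the centre [c] can meet the two edges only in their leaves [a] and [b]. *)
Lemma pair_meets_cherry c a b h : a != b -> #|h| = 2 ->
  [set c; a] :&: h != set0 -> [set c; b] :&: h != set0 ->
  h = [set a; b] \/ c \in h.
Proof.
move=> ab h2 /set0Pn[p]; rewrite !inE => /andP[pca ph].
move=> /set0Pn[q]; rewrite !inE => /andP[qcb qh].
case: (boolP (c \in h)) => ch; [by right | left].
have /eqP ep : p == a.
  by case/orP: pca ph => // /eqP->; rewrite (negbTE ch).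
have /eqP eq : q == b.
  by case/orP: qcb qh => // /eqP->; rewrite (negbTE ch).
by apply/esym/eqP; rewrite eqEcard cards2 ab h2 subUset !sub1set -ep -eq ph qh.
Qed.

Lemma pairs_disjoint_or_cherry x y : #|x| = 2 -> #|y| = 2 -> x != y ->
  x :&: y = set0 \/
  exists c a b, [/\ a != b, x = [set c; a] & y = [set c; b]].
Proof.
move=> x2 y2 xy; case: (eqVneq (x :&: y) set0) => [|/set0Pn[c]]; first by left.
rewrite inE => /andP[/(pair_through x2)[a _ ex] /(pair_through y2)[b _ ey]].
right; exists c, a, b; split=> //; apply: contra_neq xy => ab.
by rewrite ex ey ab.
Qed.

(** A pair through [c] is determined by its other point, which must lie in [z] because [c] does not;
    hence [F] has at most as many members as [z] has points. *)
Lemma through_meeting_sub c z F : pairs F -> c \notin z ->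
  (forall x, x \in F -> c \in x) -> (forall x, x \in F -> z :&: x != set0) ->
  F \subset [set [set c; d] | d in z].
Proof.
move=> F2 cz cF zF; apply/subsetP => x xF.
have [d dc ex] := pair_through (F2 x xF) (cF x xF).
have /set0Pn[e] := zF x xF; rewrite ex !inE => /andP[ez /orP[]/eqP eE].
  by rewrite -eE ez in cz.
by apply/imsetP; exists d; rewrite // -eE.
Qed.

(** Take two members of [F]. If they are disjoint, [H] lies among their 4 transversals; if they
    share a point [c], then [H] consists of pairs through [c] and at most one further pair. *)
Lemma card_meeting_two F H : 3 < #|T| -> pairs F -> pairs H -> 1 < #|F| ->
  cross_intersecting F H -> #|H| <= #|T|.
Proof.
move=> T4 F2 H2 /card_gt1P[x [y [xF yF xy]]] FH.
case: (pairs_disjoint_or_cherry (F2 _ xF) (F2 _ yF) xy) => [xy0|].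
  apply: leq_trans T4.
  apply: leq_trans (card_pairs_meeting_disjoint (F2 _ xF) (F2 _ yF)).
  apply: subset_leq_card; apply/subsetP => h hH.
  by apply: pair_meets_disjoint; rewrite ?H2 ?FH.
move=> [c [a [b [ab ex ey]]]].
have sub : H \subset [set a; b] |: star c.
  apply/subsetP => h hH; rewrite in_setU1.
  case: (@pair_meets_cherry c a b h) => //; rewrite -?ex -?ey ?H2 ?FH //.
    by move->; rewrite eqxx.
  by move=> ch; rewrite mem_star ?orbT ?H2.
have := subset_leq_card sub; rewrite cardsU1; have := card_star c; lia.
Qed.

Lemma card_meeting_three F H : pairs F -> pairs H -> 2 < #|F| ->
  (forall c, ~~ (F \subset star c)) -> cross_intersecting F H -> #|H| <= 3.
Proof.
move=> F2 H2 F3 Fstar FH; have /card_gt2P[x [y [z [[xF yF zF]]]]] := F3.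
move=> [xy yz zx].
case: (pairs_disjoint_or_cherry (F2 _ xF) (F2 _ yF) xy) => [xy0|].
  have missed w : w \in F -> w != z -> exists2 p, p \in w & p \notin z.
    move=> wF wz; apply/subsetPn; apply: contra wz => wz.
    by rewrite eqEcard wz !F2.
  (* The transversal [[set p; q]] misses [z], so at most three of the four transversals can be in
     [H]. *)
  have [p px pz] := missed x xF (ltac:(by rewrite eq_sym)).
  have [q qy qz] := missed y yF yz.
  have pqP : [set p; q] \in [set [set p; q] | p in x, q in y].
    exact: imset2_f.
  have := card_pairs_meeting_disjoint (F2 _ xF) (F2 _ yF).
  rewrite (cardsD1 [set p; q]) pqP add1n ltnS; apply: leq_trans.
  apply: subset_leq_card; apply/subsetP => h hH; rewrite in_setD1.
  rewrite pair_meets_disjoint ?H2 ?FH // andbT.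
  apply: contraNneq (FH _ _ zF hH) => ->; apply/eqP/setP => w; rewrite !inE.
  apply/andP => -[wz /orP[]/eqP e]; move: wz;
    by rewrite e ?(negbTE pz) ?(negbTE qz).
move=> [c [a [b [ab ex ey]]]].
(* A member of [H] through [c] has its other point in [w], which leaves two such pairs besides
   [[set a; b]]. *)
have /subsetPn[w wF wc] := Fstar c.
have cw : c \notin w by apply: contra wc => cw; rewrite mem_star ?F2.
have sub : H \subset [set a; b] |: [set [set c; d] | d in w].
  apply/subsetP => h hH; rewrite in_setU1.
  case: (@pair_meets_cherry c a b h) => //; rewrite -?ex -?ey ?H2 ?FH //.
    by move->; rewrite eqxx.
  move=> ch; apply/orP; right.
  rewrite -sub1set; apply: (through_meeting_sub _ cw) => u;
    rewrite in_set1 => /eqP->; by rewrite ?H2 ?FH.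
apply: leq_trans (subset_leq_card sub) _; rewrite cardsU1.
apply: leq_add (leq_b1 _) _; rewrite -(F2 w wF); exact: leq_imset_card.
Qed.

(** A pair that avoids [c] meets at most two pairs through [c], one for each of its points. *)
Lemma cross_star F H c : pairs F -> pairs H -> 2 < #|F| -> F \subset star c ->
  cross_intersecting F H -> H \subset star c.
Proof.
move=> F2 H2 F3 /subsetP Fc FH; apply/subsetP => h hH.
apply: mem_star; first exact: H2.
apply: contraLR F3 => ch; rewrite -leqNgt -(H2 h hH).
apply: leq_trans (leq_imset_card (fun d => [set c; d]) _).
apply: subset_leq_card; apply: through_meeting_sub => // x xF.
  by rewrite star_through ?Fc.
by rewrite setIC FH.
Qed.

Lemma cross_intersecting_bound F H : 4 < #|T| -> pairs F -> pairs H ->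
  1 < #|F| -> 1 < #|H| -> cross_intersecting F H ->
  #|F| + #|H| + 3 <= #|T|.*2 \/
  exists c, F \subset star c /\ H \subset star c.
Proof.
move=> T5 F2 H2 F1 H1 FH; have HF := cross_intersecting_sym FH.
have := card_meeting_two (ltnW T5) F2 H2 F1 FH.
have := card_meeting_two (ltnW T5) H2 F2 H1 HF => Fn Hn.
(* A family of only two pairs gives a total of at most 2 + |T|, and 2 + |T| + 3 is at most 2|T| once
   |T| is at least 5. *)
have [F3|F3] := leqP #|F| 2; first by left; lia.
have [H3|H3] := leqP #|H| 2; first by left; lia.
case: (boolP [exists c, F \subset star c]) => [/existsP[c Fc]|].
  by right; exists c; split=> //; apply: cross_star FH.
rewrite negb_exists => /forallP Fstar.
have Hstar c : ~~ (H \subset star c).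
  by apply: contra (Fstar c) => Hc; apply: cross_star HF.
(* Neither family is contained in a star, so both have at most 3 members, and 3 + 3 + 3 < 10. *)
have := card_meeting_three F2 H2 F3 Fstar FH.
by have := card_meeting_three H2 F2 H3 Hstar HF; left; lia.
Qed.

End CrossIntersectingPairs.

(** * Vertex separators in a graph *)

Section Separators.
Variable G : sgraph.

Lemma disconnectedP (S : {set G}) : ~ connected (delete S) ->
  exists A B : {set G},
    [/\ 0 < #|A|, 0 < #|B|, [disjoint A & B], A :|: B = ~: S
      & forall a b, a \in A -> b \in B -> ~~ adj a b].
Proof.
move=> nconn.
have /existsP[x /existsP[y nxy]] :
    [exists x, exists y, ~~ connect (@adj (delete S)) x y].
  apply: contra_notT nconn => /existsPn all_conn x y.
  by have /existsPn/(_ y) := all_conn x; rewrite negbK.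
(* [A] is the component of [x] after the deletion and [B] is everything else that remains; an edge
   between them would extend a path from [x]. *)
pose A := [set val z | z : delete S & connect (@adj (delete S)) x z].
pose B := [set val z | z : delete S & ~~ connect (@adj (delete S)) x z].
exists A, B; split.
- by apply/card_gt0P; exists (val x); apply: imset_f; rewrite inE connect0.
- by apply/card_gt0P; exists (val y); apply: imset_f; rewrite inE.
- rewrite -setI_eq0; apply/eqP/setP => v; rewrite !inE; apply/andP => -[].
  case/imsetP => u; rewrite inE => xu ->; case/imsetP => w; rewrite inE => xw.
  by move=> /val_inj e; rewrite e (negbTE xw) in xu.
- apply/setP => v; rewrite !inE; apply/orP/idP.
    by case=> /imsetP[u _ ->]; apply: (valP u).
  move=> vS; case: (boolP (connect (@adj (delete S)) x (Sub v vS))) => xv.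
    by left; apply/imsetP; exists (Sub v vS); rewrite ?inE.
  by right; apply/imsetP; exists (Sub v vS); rewrite ?inE.
- move=> _ _ /imsetP[u + ->] /imsetP[w + ->]; rewrite !inE => xu.
  apply: contra => uw.
  by apply: connect_trans xu (connect1 _).
Qed.

(** The first step of a path from [x] to [y] would lead to a deleted vertex. *)
Lemma nbhd_separates (x y : G) :
  x != y -> ~~ adj x y -> ~ connected (delete (nbhd x)).
Proof.
move=> xy nxy conn.
have xN : x \notin nbhd x by rewrite inE adj_irrefl.
have yN : y \notin nbhd x by rewrite inE.
have /connectP[[|u p] /=] := conn (Sub x xN) (Sub y yN).
  by move=> _ /(congr1 val) /= e; rewrite e eqxx in xy.
by rewrite {1}/del_adj => /andP[xu _] _; have := valP u; rewrite inE xu.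
Qed.

Lemma singleton_side k (S A B : {set G}) : regular G k -> #|A| = 1 ->
  A :|: B = ~: S -> (forall a b, a \in A -> b \in B -> ~~ adj a b) -> k <= #|S|.
Proof.
move=> Greg /eqP/cards1P[x ->] AB nAB; rewrite -(Greg x).
apply: subset_leq_card; apply/subsetP => v; rewrite inE => xv.
apply: contraLR xv => vS; have : v \in [set x] :|: B by rewrite AB inE.
rewrite !inE => /orP[/eqP->|vB]; first by rewrite adj_irrefl.
by rewrite nAB ?inE.
Qed.

End Separators.

(** Applied to [n - 2], this says that the number of vertices exceeds the valency by 2n - 3, which
    is exactly the bound wanted for the two sides of a separation. *)
Lemma bin2_gap n : 'C(n.+2, 2) = 'C(n, 2) + n.*2.+1.
Proof. by rewrite !binS !bin1 bin0; lia. Qed.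

(** * The switched complement of the triangular graph *)

Section SwitchedComplement.
Variables (n : nat) (n5 : 5 <= n).
Let G := co_triangular' n5.
Let phi := swap_aut (elt1 n5) (elt2 n5).

Lemma card_co_triangular' : #|G| = 'C(n, 2).
Proof.
by rewrite card_sig -[in RHS](card_ord n) -card_draws cardsE.
Qed.

(** Distinct 2-subsets share at most one point, so non-adjacency in the triangular graph means
    disjointness for them; for equal ones both sides are false. *)
Lemma co_triangular'_adjE (x y : G) :
  @adj G x y = (val (phi x) :&: val y == set0).
Proof.
rewrite [LHS]switch_adjE /= /compl_adj /= /tri_adj -/phi -val_eqE.
move: (valP (phi x)) (valP y) => /=.
move: (val (phi x)) (val y) => u v /eqP u2 /eqP v2.
have [->|uv] := eqVneq u v; first by rewrite setIid -cards_eq0 v2.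
have : #|u :&: v| < 2.
  rewrite ltn_neqAle -[X in _ <= X]u2 subset_leq_card ?subsetIl // andbT.
  apply: contra uv => /eqP uv2; rewrite eqEcard u2 v2 andbT.
  by apply/setIidPl/eqP; rewrite eqEcard subsetIl uv2 u2.
by rewrite -cards_eq0; case: #|_| => [|[]].
Qed.

(** The neighbours of [x] are the 2-subsets of the complement of [phi x], which has n - 2 points. *)
Lemma co_triangular'_regular : regular G 'C(n - 2, 2).
Proof.
move=> x; have /eqP x2 := valP (phi x).
have <- : #|~: val (phi x)| = n - 2 by rewrite cardsCs setCK x2 card_ord.
rewrite -cards_draws -(card_imset _ val_inj); apply: eq_card => y.
rewrite inE; apply/imsetP/andP => [[z + ->]|[yx y2]].
  rewrite inE co_triangular'_adjE setI_eq0 => xz.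
  by rewrite -disjoints_subset disjoint_sym xz (valP z).
exists (Sub y y2 : pair2 n) => //.
by rewrite inE co_triangular'_adjE setI_eq0 disjoint_sym disjoints_subset.
Qed.

(** [phi] fixes every pair containing both or neither of [a] and [b]: take [[set a; b]] if [c] is
    one of them, and otherwise join [c] to a point outside [[set a; b; c]]. *)
Lemma fixed_pair_through (c : 'I_n) :
  exists2 e : pair2 n, phi e = e & c \in val e.
Proof.
set a := elt1 n5; set b := elt2 n5.
have ab : a != b by [].
have fixed (x : {set 'I_n}) (x2 : #|x| == 2) : (a \in x) = (b \in x) ->
    phi (Sub x x2 : pair2 n) = Sub x x2.
  move=> abx; apply: val_inj; rewrite permE /= /swap_set abx.
  by rewrite andbN.
have [cab|] := boolP (c \in [set a; b]).
  have ab2 : #|[set a; b]| == 2 by rewrite cards2 ab.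
  by exists (Sub [set a; b] ab2); rewrite ?fixed // !inE !eqxx orbT.
rewrite !inE negb_or => /andP[ca cb].
have [d] : exists d, d \notin [set a; b; c].
  apply/existsP; rewrite -negb_forall; apply/negP => /forallP all3.
  have : #|'I_n| <= #|[set a; b; c]|.
    by rewrite -cardsT; apply/subset_leq_card/subsetP => d _.
  rewrite card_ord setUC cardsU1 cards2; lia.
rewrite !inE !negb_or -andbA => /and3P[da db dc].
have cd2 : #|[set c; d]| == 2 by rewrite cards2 (eq_sym c) dc.
exists (Sub [set c; d] cd2); rewrite ?inE ?eqxx // fixed //.
rewrite !inE !(eq_sym a) !(eq_sym b).
by rewrite (negbTE ca) (negbTE cb) (negbTE da) (negbTE db).
Qed.

Lemma co_triangular'_separated (A B : {set G}) : 1 < #|A| -> 1 < #|B| ->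
  [disjoint A & B] -> (forall a b, a \in A -> b \in B -> ~~ adj a b) ->
  #|A| + #|B| + 3 <= n.*2.
Proof.
move=> A1 B1 dAB nAB.
pose F : {set {set 'I_n}} := [set val (phi a) | a in A].
pose H : {set {set 'I_n}} := [set val b | b : G in B].
have cF : #|F| = #|A| by apply: card_imset => x y /val_inj/perm_inj.
have cH : #|H| = #|B| by apply: card_imset; apply: val_inj.
have F2 : pairs F by move=> _ /imsetP[a _ ->]; apply/eqP/(valP (phi a)).
have H2 : pairs H by move=> _ /imsetP[b _ ->]; apply/eqP/(valP b).
have FH : cross_intersecting F H.
  move=> _ _ /imsetP[a aA ->] /imsetP[b bB ->].
  by have := nAB a b aA bB; rewrite co_triangular'_adjE.
have := @cross_intersecting_bound _ F H; rewrite card_ord cF cH.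
case=> // -[c [Fc Hc]].
have [e phie ce] := fixed_pair_through c.
have e_star : val e \in star c by apply: mem_star => //; apply/eqP/(valP e).
(* If [val e] were in both families, then [e] would be in [B] and, being fixed by [phi], also in
   [A]. *)
have sub : F :&: H \subset star c :\ val e.
  rewrite subsetD1 (subset_trans (subsetIl _ _)) //=.
  apply/negP; rewrite inE => /andP[].
  move=> /imsetP[a aA /val_inj ea] /imsetP[b bB /val_inj eb].
  have ae : a = e by apply: (@perm_inj _ phi); rewrite -ea phie.
  by have := disjointFr dAB aA; rewrite ae eb bB.
have ltI : #|F :&: H| < #|star c|.
  exact: leq_ltn_trans (subset_leq_card sub) (proper_card (properD1 e_star)).
have leU : #|F :|: H| <= #|star c| by rewrite subset_leq_card // subUset Fc.
(* The union has at most n - 1 members and the intersection at most n - 2, for a total of 2n - 3. *)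
have := cardsUI F H; have := card_star c; rewrite cF cH card_ord; lia.
Qed.

End SwitchedComplement.

Theorem theorem1 (n : nat) (n5 : (5 <= n)%N) :
  exists k : nat,
    regular (co_triangular' n5) k /\
    is_vertex_connectivity (co_triangular' n5) k.
Proof.
set G := co_triangular' n5; have Greg := @co_triangular'_regular n n5.
have cardG : #|G| + 3 = 'C(n - 2, 2) + n.*2.
  rewrite card_co_triangular' -{1}(subnK (ltac:(lia) : 2 <= n)) addn2 bin2_gap.
  by lia.
exists 'C(n - 2, 2); split=> //; split.
  have /card_gt0P[x _] : 0 < #|G| by lia.
  (* Since 2n - 3 > 1, a closed neighbourhood does not exhaust the vertices, so [nbhd x] separates
     [x] from some [y]. *)
  have /subsetPn[y _] : ~~ ([set: G] \subset x |: nbhd x).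
    apply/negP => /subset_leq_card; rewrite cardsT cardsU1 Greg; lia.
  rewrite !inE negb_or => /andP[yx nxy].
  by exists (nbhd x) => //; apply: (@nbhd_separates G x y); rewrite // eq_sym.
move=> S /disconnectedP[A [B [A0 B0 dAB AB nAB]]].
have [A1|A1] := eqVneq #|A| 1; first exact: singleton_side A1 AB nAB.
have [B1|B1] := eqVneq #|B| 1.
  apply: (singleton_side Greg B1); first by rewrite setUC; exact: AB.
  by move=> b a bB aA; rewrite adj_sym nAB.
have {}A1 : 1 < #|A| by rewrite ltn_neqAle eq_sym A1.
have {}B1 : 1 < #|B| by rewrite ltn_neqAle eq_sym B1.
have sep : #|A| + #|B| + 3 <= n.*2 := co_triangular'_separated A1 B1 dAB nAB.
have cardS : #|S| + #|~: S| = #|G| := cardsC S.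
(* By disjointness |A| + |B| is the number of vertices outside [S]; subtracting at most 2n - 3 from
   the order leaves at least the valency for [S]. *)
have := leq_card_setU A B; rewrite AB dAB => -[_ /eqP]; lia.
Qed.
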